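(* For every $\alpha\in(0,2)$ there exist constants $\mathcal C_1,\mathcal C_2>0$ such that $\mathbb P(\xi_\alpha^\delta>x)\le \mathcal C_1 e^{-\mathcal C_2\log^2 x}$ for all $x\ge1$ and all $\delta\in[0,1]$.
   Context: $B_\alpha$ is fractional Brownian motion with $\mathrm{Cov}(B_\alpha(t),B_\alpha(s))=\frac{|t|^\alpha+|s|^\alpha-|t-s|^\alpha}{2}$, $t,s\in\mathbb R$. Let $Z_\alpha(t)=\sqrt2B_\alpha(t)-|t|^\alpha$. For $\delta>0$, $\xi_\alpha^\delta=\dfrac{\sup_{t\in\delta\mathbb Z}e^{Z_\alpha(t)}}{\delta\sum_{t\in\delta\mathbb Z}e^{Z_\alpha(t)}}$; for $\delta=0$, $\xi_\alpha^0=\dfrac{\sup_{t\in\mathbb R}e^{Z_\alpha(t)}}{\int_{\mathbb R}e^{Z_\alpha(t)}\,dt}$. *)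

(* Defs.v *)
From HB Require Import structures.
From mathcomp Require Import all_boot all_order all_algebra.
From mathcomp Require Import all_classical all_reals all_analysis.
Set Implicit Arguments. Unset Strict Implicit. Unset Printing Implicit Defensive.
Import Order.TTheory GRing.Theory Num.Theory.
Import numFieldNormedType.Exports.
Local Open Scope classical_set_scope.
Local Open Scope ring_scope.

Section fbm.
Context {R : realType} {d : measure_display} {Omega : measurableType d}.
Variable P : probability Omega R.

(* Covariance of fractional Brownian motion of Hurst index alpha/2:
   (|t|^alpha + |s|^alpha - |t-s|^alpha)/2. *)
Definition fbm_cov (alpha t s : R) : R :=
  (`|t| `^ alpha + `|s| `^ alpha - `|t - s| `^ alpha) / 2.

Definition centered_gaussian (X : Omega -> R) (v : R) : Prop :=
  measurable_fun [set: Omega] X /\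
  forall A : set R, measurable A ->
    P (X @^-1` A) =
      if (0 < v)%R then normal_prob 0 (Num.sqrt v) A else \d_(0:R) A.

Definition is_fbm (alpha : R) (B : R -> Omega -> R) : Prop :=
  forall (n : nat) (t c : 'I_n -> R),
    centered_gaussian (fun w => \sum_(i < n) c i * B (t i) w)
      (\sum_(i < n) \sum_(j < n) c i * c j * fbm_cov alpha (t i) (t j)).

Definition Zproc (alpha : R) (B : R -> Omega -> R) (t : R) (w : Omega) : R :=
  Num.sqrt 2 * B t w - `|t| `^ alpha.

Definition xi (alpha delta : R) (B : R -> Omega -> R) (w : Omega) : \bar R :=
  if delta == 0 then
    (ereal_sup [set (expR (Zproc alpha B t w))%:E | t in [set: R]] /
     \int[lebesgue_measure]_(t in [set: R]) (expR (Zproc alpha B t w))%:E)%E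
  else
    (ereal_sup [set (expR (Zproc alpha B (k%:~R * delta) w))%:E | k in [set: int]] /
     (delta%:E * \esum_(k in [set: int]) (expR (Zproc alpha B (k%:~R * delta) w))%:E))%E.

End fbm.

(* Main.v *)
(** If the ratio exceeds x then, L being ln x, some grid point t has
    Z(t) >= Z(0) while Z drops by at least L on [t, t+1], since otherwise the
    denominator is at least exp(Z(t)) / x.  Let k be the integer part of t,
    m = (|k|+2)^(alpha/2) and V the oscillation of B on [k, k+2].  Writing
    |s|^alpha as the square of |s|^(alpha/2), which is subadditive, the drop gives
    L <= 3 V + 2 m + 1, while Z(t) >= Z(0) gives
    m^2 <= 18 + 3 (V + |B(k) - B(0)|).  Hence V is of order L + m, or
    |B(k) - B(0)| is of order m (L + m), up to finitely many k and bounded L.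
    Dyadic chaining bounds the probability of the former, and a single Gaussian
    tail that of the latter, by C exp(-c (L^2 + m^2)); this is summable over k
    because m^2 = (|k|+2)^alpha. *)
Require Import Defs.
From HB Require Import structures.
From mathcomp Require Import all_boot all_order all_algebra.
From mathcomp Require Import all_classical all_reals all_analysis.
From mathcomp Require Import measurable_realfun lra ring.
Set Implicit Arguments. Unset Strict Implicit. Unset Printing Implicit Defensive.
Import Order.TTheory GRing.Theory Num.Theory.
Import numFieldNormedType.Exports.
Local Open Scope classical_set_scope.
Local Open Scope ring_scope.

(** * Deterministic inequalities: powers, dyadic chaining, one block, a series *)

Section Deterministic.
Context {R : realType}.
Implicit Types (f : R -> R) (a b v r x y : R).

(** A fraction z / (x + y) in (0, 1] does not decrease when raised to the power b <= 1; add this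
    over z = x and z = y. *)
Lemma powRD_le x y b : 0 <= x -> 0 <= y -> 0 <= b <= 1 ->
  (x + y) `^ b <= x `^ b + y `^ b.
Proof.
rewrite le_eqVlt => /predU1P[<-|x0]; first by rewrite add0r lerDr powR_ge0.
rewrite le_eqVlt => /predU1P[<-|y0]; first by rewrite addr0 lerDl powR_ge0.
move=> /andP[b0 b1].
have xy0 : 0 < x + y by rewrite addr_gt0.
have aux z : 0 < z -> z <= x + y -> z / (x + y) * (x + y) `^ b <= z `^ b.
  move=> z0 zxy; rewrite -[X in _ <= X `^ b](divfK (lt0r_neq0 xy0)).
  have ? := ltW z0; have ? := ltW xy0.
  rewrite powRM ?divr_ge0//.
  rewrite ler_wpM2r ?powR_ge0// ger1_powR//.
  by rewrite divr_gt0//= ler_pdivrMr// mul1r.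
apply: (le_trans _ (lerD (aux x x0 _) (aux y y0 _))); rewrite ?lerDl ?lerDr ?(ltW x0) ?(ltW y0)//.
by rewrite -mulrDl -mulrDl divff ?gt_eqF// mul1r.
Qed.

Lemma powR_sqr_half x b : 0 <= x -> x `^ b = (x `^ (b / 2)) ^+ 2.
Proof.
by move=> x0; rewrite -powR_mulrn ?powR_ge0// -powRrM divfK.
Qed.

(** Level-n points of [a, a + 2]. Length two is what a block needs: t lies in [k, k + 1) and s in
    [t, t + 1]. *)
Definition dyadic a n i := a + 2 * (i%:R / 2 ^+ n) : R.

Lemma dyadicS_double a n i : dyadic a n.+1 i.*2 = dyadic a n i.
Proof.
by rewrite /dyadic exprS -muln2 natrM; congr (_ + _ * _); field; rewrite expf_neq0.
Qed.

(** Induction on the level: an even index is a point of the previous level, an odd one lies a single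
    increment to the right of such a point. The thresholds (1 - r) r^j, j <= n, add up to 1 -
    r^(n+1). *)
Lemma chaining_dyadic f a v r : 0 <= v -> 0 <= r <= 1 ->
  (forall n i, (i < 2 ^ n)%N ->
    `|f (dyadic a n i.+1) - f (dyadic a n i)| <= v * ((1 - r) * r ^+ n)) ->
  forall n i, (i <= 2 ^ n)%N ->
    `|f (dyadic a n i) - f a| <= v * (1 - r ^+ n.+1).
Proof.
move=> v0 /andP[r0 r1] H; elim=> [|n IH] i.
  have d0 : dyadic a 0 0 = a by rewrite /dyadic mul0r mulr0 addr0.
  case: i => [|[|//]] _; rewrite ?expr1.
    by rewrite d0 subrr normr0 mulr_ge0// subr_ge0.
  by have := H 0%N 0%N isT; rewrite d0 expr0 mulr1.
rewrite -{1 2}(odd_double_half i); case: (odd i) => /=.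
  rewrite add1n => hi.
  have hi2 : (i./2 < 2 ^ n)%N by rewrite -ltn_double -[ltnRHS]muln2 -expnSr.
  have := H n.+1 i./2.*2 hi; have := IH _ (ltnW hi2); rewrite dyadicS_double => h1 h2.
  apply: le_trans (ler_distD (f (dyadic a n i./2)) _ _) _.
  apply: le_trans (lerD h2 h1) _.
  by rewrite -mulrDr ler_wpM2l// !exprS; nra.
rewrite add0n dyadicS_double => hi.
have hi2 : (i./2 <= 2 ^ n)%N by rewrite -leq_double -[leqRHS]muln2 -expnSr.
apply: le_trans (IH _ hi2) _; rewrite ler_wpM2l// lerB//.
by rewrite exprSr ler_piMr// exprn_ge0.
Qed.

(** The level-n points [u n] just below x are within 2 / 2^n of it, so the dyadic bound passes to
    the limit by continuity. *)
Lemma chaining f a v r : continuous f -> 0 <= v -> 0 <= r <= 1 ->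
  (forall n i, (i < 2 ^ n)%N ->
    `|f (dyadic a n i.+1) - f (dyadic a n i)| <= v * ((1 - r) * r ^+ n)) ->
  forall x, a <= x <= a + 2 -> `|f x - f a| <= v.
Proof.
move=> cf v0 r01 H x /andP[ax xa].
pose y n := (x - a) / 2 * 2 ^+ n.
pose u n := dyadic a n (Num.truncn (y n)).
have y0 n : 0 <= y n by rewrite mulr_ge0 ?exprn_ge0 ?divr_ge0 ?subr_ge0.
have u_lt n : `|x - u n| <= 2 * 2^-1 ^+ n.
  have /andP[h1 h2] := truncn_itv (y0 n).
  have -> : x = a + 2 * (y n / 2 ^+ n).
    by rewrite /y mulfK ?expf_neq0// mulrC divfK// addrC subrK.
  rewrite /u /dyadic opprD addrACA subrr add0r -mulrBr -mulrBl.
  rewrite normrM ger0_norm// ler_wpM2l// normrM exprVn.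
  rewrite [X in _ * X]ger0_norm ?invr_ge0 ?exprn_ge0//.
  rewrite ler_piMl ?invr_ge0 ?exprn_ge0//.
  rewrite ger0_norm ?subr_ge0//; move: h2; rewrite -natr1; lra.
have ux : u n @[n --> \oo] --> x.
  apply/cvgrPdist_le => /= e e0.
  have /cvgrPdist_le/(_ e e0) : (2 * 2^-1 ^+ n : R) @[n --> \oo] --> (0 : R).
    rewrite -(mulr0 2); apply: cvgM; first exact: cvg_cst.
    by apply: cvg_expr; rewrite ger0_norm ?invf_lt1 ?ltr1n.
  apply: filterS => n; rewrite sub0r normrN => h.
  exact: le_trans (le_trans (u_lt n) (ler_norm _)) h.
have cv : `|f (u n) - f a| @[n --> \oo] --> `|f x - f a|.
  apply: cvg_norm; apply: cvgB; last exact: cvg_cst.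
  by apply: continuous_cvg => //; exact: cf.
rewrite -(cvg_lim _ cv)//; apply: limr_le; first by apply/cvg_ex; eexists; exact: cv.
apply: nearW => n; apply: le_trans (chaining_dyadic v0 r01 H _) _.
  rewrite -(@ler_nat R); have /andP[h _] := truncn_itv (y0 n); apply: le_trans h _.
  by rewrite natrX ler_piMl ?exprn_ge0//; lra.
by case/andP: r01 => r0 r1; rewrite ler_piMr// gerBl exprn_ge0.
Qed.

(* [mt], [ms], [m] stand for [|t|^(alpha/2)], [|s|^(alpha/2)],
   [(|k|+2)^(alpha/2)], and [q] for [sqrt 2]. *)
Lemma block_dichotomy (L V U mt ms m q bt bs bk b0 : R) :
  0 <= L -> 0 <= q <= 3 / 2 -> 0 <= ms <= mt + 1 -> 0 <= mt <= m -> 1 <= m <= mt + 3 ->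
  `|bt - bk| <= V -> `|bs - bk| <= V -> `|bk - b0| <= U ->
  q * b0 <= q * bt - mt ^+ 2 ->
  q * bs - ms ^+ 2 + L <= q * bt - mt ^+ 2 ->
  V <= (L + m) / 12 -> U <= m * (L + m) / 36 -> m < 8 /\ L < 40.
Proof.
move=> L0 /andP[q0 q1] /andP[ms0 ms1] /andP[mt0 mt1] /andP[m1 m3].
move=> /ler_normlP[ht1 ht2] /ler_normlP[hs1 hs2] /ler_normlP[hk1 hk2] h0 hL hV hU.
have V0 : 0 <= V by lra.
have U0 : 0 <= U by lra.
have qle (y z : R) : y <= z -> 0 <= z -> q * y <= 3 / 2 * z.
  move=> yz z0; apply: le_trans (ler_wpM2l q0 yz) _; exact: ler_wpM2r.
have e1 : q * (bt - b0) <= 3 / 2 * (U + V) by apply: qle; lra.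
have e2 : q * (bt - bs) <= 3 / 2 * (2 * V) by apply: qle; lra.
have ms2 : ms ^+ 2 <= (mt + 1) ^+ 2 by apply: lerXn2r; rewrite ?nnegrE; lra.
have e3 : ms ^+ 2 - mt ^+ 2 <= 2 * m + 1 by lra.
have m2 : m ^+ 2 <= (mt + 3) ^+ 2 by apply: lerXn2r; rewrite ?nnegrE; lra.
(* (mt + 3)^2 <= 2 mt^2 + 18, and mt^2 <= q (bt - b0) is bounded by [e1]. *)
have e4 : m ^+ 2 <= 18 + 3 * (U + V).
  have : 0 <= (mt - 3) ^+ 2 by exact: sqr_ge0.
  lra.
(* The drop gives L <= 3 V + 2 m + 1; inserting the bound on V leaves L <= 3 m + 4/3, and 1 <= m. *)
have L5 : L <= 5 * m by lra.
have mL : m * (L + m) <= m * (6 * m) by apply: ler_wpM2l; lra.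
(* With L <= 5 m, [e4] becomes m^2 <= 36 + 3 m, impossible for m >= 8; then 40 = 5 * 8. *)
have : m < 8.
  rewrite ltNge; apply/negP => m8.
  have : 8 * m <= m * m by apply: ler_wpM2r; lra.
  lra.
by split => //; lra.
Qed.

(** Supplies the scale hypotheses of [block_dichotomy], from monotonicity and subadditivity of the
    power alpha/2 <= 1; the final 3 bounds 3^(alpha/2). *)
Lemma powR_block (alpha t s : R) (k : int) : 0 <= alpha <= 2 ->
  k%:~R <= t < k%:~R + 1 -> t <= s <= t + 1 ->
  let m x := x `^ (alpha / 2) in
  [/\ m `|s| <= m `|t| + 1, m `|t| <= m (`|k|%:~R + 2), 1 <= m (`|k|%:~R + 2)
    & m (`|k|%:~R + 2) <= m `|t| + 3].
Proof.
move=> /andP[a0 a2] /andP[kt tk] /andP[ts st] m.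
have b01 : 0 <= alpha / 2 <= 1 by lra.
have b0 : 0 <= alpha / 2 by lra.
have k0 : 0 <= `|k|%:~R :> R by rewrite ler0z.
have kE : `|k|%:~R = `|k%:~R : R| by rewrite intr_norm.
have mono x y : 0 <= x -> x <= y -> m x <= m y.
  by move=> x0 xy; apply: ge0_ler_powR; rewrite // nnegrE // (le_trans x0).
have m1 : m 1 = 1 by rewrite /m powR1.
have m3 : m 3 <= 3 by apply: ler1_powR => //; lra.
split.
- rewrite -m1; apply: le_trans (powRD_le _ _ b01) => //; apply: mono => //.
  apply: le_trans (_ : `|t| + `|s - t| <= _).
    by rewrite -{1}(subrK t s) addrC ler_normD.
  by rewrite lerD2l ger0_norm; lra.
- apply: mono => //; rewrite kE -lerBlDl.
  by apply: le_trans (lerB_dist _ _) _; rewrite ger0_norm; lra.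
- by rewrite -{1}m1; apply: mono; lra.
- apply: le_trans (_ : m (`|t| + 3) <= _); last first.
    by apply: le_trans (powRD_le _ _ b01) _ => //; rewrite lerD2l.
  apply: mono; first lra.
  rewrite kE; have : `|k%:~R| - `|t| <= `|k%:~R - t| by exact: lerB_dist.
  by rewrite distrC (@ger0_norm _ (t - k%:~R)); lra.
Qed.

(** With y = (n + 2)^alpha, exp(c y) >= (c y / m)^m, and alpha m >= 2 gives y^m >= (n + 2)^2; the
    resulting bound telescopes. *)
Lemma expR_powR_summable (alpha c : R) : 0 < alpha -> 0 < c ->
  exists2 K, 0 < K & forall N,
    \sum_(n < N) expR (- c * (n%:R + 2) `^ alpha) <= K.
Proof.
move=> a0 c0.
pose m := (Num.truncn (2 / alpha)).+1.
have am : 2 <= alpha * m%:R.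
  have := truncnS_gt (2 / alpha); rewrite -/m => h.
  by rewrite mulrC -ler_pdivrMr// ltW.
have cm0 : 0 < c / m%:R by rewrite divr_gt0// ltr0n.
pose K := (c / m%:R) ^- m.
have K0 : 0 < K by rewrite invr_gt0 exprn_gt0.
exists K => // N.
have term n : expR (- c * (n%:R + 2) `^ alpha) <= K * (n.+1%:R^-1 - n.+2%:R^-1).
  have n2 : (1:R) <= n%:R + 2 by have := ler0n R n; lra.
  set y := _ `^ _; have y0 : 0 < y by rewrite powR_gt0// (lt_le_trans _ n2).
  apply: (@le_trans _ _ (K * (n%:R + 2) ^- 2)); last first.
    rewrite ler_wpM2l ?(ltW K0)// -!natr1.
    have n0 := ler0n R n.
    rewrite (_ : _ - _ = ((n%:R + 1) * (n%:R + 2))^-1).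
      by rewrite lef_pV2 ?posrE ?mulr_gt0 ?exprn_gt0//; nra.
    by field; apply/andP; split; rewrite gt_eqF//; lra.
  rewrite mulNr expRN /K -invfM lef_pV2 ?posrE ?expR_gt0//; last first.
    by rewrite mulr_gt0 ?exprn_gt0//; lra.
  apply: (@le_trans _ _ ((c / m%:R) ^+ m * y ^+ m)).
    rewrite ler_wpM2l ?exprn_ge0 ?(ltW cm0)//.
    rewrite -[X in X <= _]powR_mulrn; last exact: le_trans n2.
    by rewrite -[X in _ <= X]powR_mulrn ?(ltW y0)// /y -powRrM; apply: ler_powR.
  rewrite -exprMn (_ : c * y = m%:R * (c / m%:R * y)); last first.
    by rewrite mulrA [_ * (c / _)]mulrCA divff ?mulr1// pnatr_eq0.
  have cy0 : 0 <= c / m%:R * y by apply: mulr_ge0; exact: ltW.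
  rewrite expRM_natl; apply: lerXn2r; [by []|by rewrite nnegrE expR_ge0|].
  by have := expR_ge1Dx (c / m%:R * y); lra.
apply: le_trans (ler_sum _ (fun (i : 'I_N) _ => term i)) _.
rewrite -mulr_sumr ler_piMr ?(ltW K0)//.
rewrite -(big_mkord xpredT (fun n => n.+1%:R^-1 - n.+2%:R^-1)).
rewrite (@telescope_sumr_eq _ 0 N (fun n => - n.+1%:R^-1)) //.
  by rewrite opprK invr1 addrC gerBl invr_ge0.
by move=> k _; rewrite opprK addrC.
Qed.

End Deterministic.

(** * Gaussian tail bounds *)

Section GaussianTail.
Context {R : realType}.
Implicit Types (s u v : R).

Lemma measurable_norm_ge u : measurable [set y : R | u <= `|y|].
Proof.
have := @measurable_realfun.normr_measurable R setT measurableT _ (measurable_itv `[u, +oo[).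
rewrite setTI; congr measurable; apply/seteqP.
by split => y; rewrite /= in_itv/= andbT.
Qed.

(* On [u <= |y|] the density of variance [s^2] is at most
   [sqrt 2 * exp (- u^2 / (4 s^2))] times the density of variance [2 s^2]. *)
Lemma normal_prob_tail s u : 0 < s -> 0 <= u ->
  (normal_prob 0 s [set y | (u <= `|y|)%R] <=
    (2 * expR (- (u ^+ 2 / (4 * s ^+ 2))))%:E)%E.
Proof.
move=> s0 u0; pose s' := Num.sqrt 2 * s.
have s'0 : 0 < s' by rewrite mulr_gt0// sqrtr_gt0.
pose c := Num.sqrt 2 * expR (- (u ^+ 2 / (4 * s ^+ 2))).
have c0 : 0 <= c by rewrite mulr_ge0 ?expR_ge0// sqrtr_ge0.
have mA := measurable_norm_ge u.
have mpdf t : measurable_fun [set: R] (EFin \o normal_pdf 0 t).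
  by apply/measurable_EFinP; exact: measurable_normal_pdf.
have pdfle y : u <= `|y| -> normal_pdf 0 s y <= c * normal_pdf 0 s' y.
  move=> uy; rewrite !normal_pdfE ?gt_eqF//.
  have -> : normal_peak s = Num.sqrt 2 * normal_peak s'.
    rewrite /normal_peak (_ : s' ^+ 2 * pi *+ 2 = 2 * (s ^+ 2 * pi *+ 2)).
      by rewrite sqrtrM// invfM mulrA divff ?mul1r// gt_eqF// sqrtr_gt0.
    by rewrite /s' exprMn sqr_sqrtr// -!mulrA mulrnAr.
  rewrite /c -!mulrA ler_wpM2l ?sqrtr_ge0// mulrCA ler_wpM2l ?normal_peak_ge0//.
  rewrite /normal_fun -expRD ler_expR subr0 /s' exprMn sqr_sqrtr//.
  have u2y : u ^+ 2 <= y ^+ 2 by rewrite -(real_normK (num_real y)) lerXn2r ?nnegrE.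
  rewrite -subr_ge0 (_ : _ - _ = (y ^+ 2 - u ^+ 2) / (4 * s ^+ 2)).
    by apply: divr_ge0; [rewrite subr_ge0|apply: mulr_ge0; rewrite ?sqr_ge0].
  by field; rewrite gt_eqF.
rewrite /normal_prob.
apply: (@le_trans _ _ (\int[lebesgue_measure]_(y in [set y : R | (u <= `|y|)%R])
    (c%:E * (normal_pdf 0 s' y)%:E))%E).
  apply: ge0_le_integral => //.
  - by move=> y _; rewrite lee_fin normal_pdf_ge0.
  - by apply: measurable_funTS; exact: mpdf.
  - by apply: measurable_funTS; apply: measurable_funeM; exact: mpdf.
rewrite ge0_integralZl_EFin//; last 2 first.
  by move=> y _; rewrite lee_fin normal_pdf_ge0.
  by apply: measurable_funTS; exact: mpdf.
apply: (@le_trans _ _ (c%:E * 1)%E).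
  rewrite lee_wpmul2l ?lee_fin// -(integral_normal_pdf 0 s').
  apply: ge0_subset_integral => //; first exact: mpdf.
  by move=> y _; rewrite lee_fin normal_pdf_ge0.
rewrite mule1 lee_fin ler_wpM2r ?expR_ge0//.
by rewrite -[leRHS]ger0_norm// -sqrtr_sqr ler_wsqrtr// expr2; lra.
Qed.

Context {d : measure_display} {Omega : measurableType d}.
Variable P : probability Omega R.

(** Only an upper bound v of the variance enters, so degenerate laws are covered: since u > 0, the
    point mass at 0 does not charge the tail. *)
Lemma centered_gaussian_tail (X : Omega -> R) v0 v u :
  centered_gaussian P X v0 -> v0 <= v -> 0 < v -> 0 < u ->
  measurable [set w | u <= `|X w|] /\
  (P [set w | (u <= `|X w|)%R] <= (2 * expR (- (u ^+ 2 / (4 * v))))%:E)%E.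
Proof.
move=> [mX PX] v0v v_gt0 u0.
have mA := measurable_norm_ge u.
split; first by have := mX measurableT _ mA; rewrite setTI.
have := PX _ mA; rewrite /preimage/= => ->.
case: ifPn => [v00|_].
  apply: le_trans (normal_prob_tail _ (ltW u0)) _; first by rewrite sqrtr_gt0.
  rewrite lee_fin ler_wpM2l// ler_expR lerN2 sqr_sqrtr ?(ltW v00)//.
  by rewrite ler_wpM2l ?sqr_ge0// lef_pV2 ?posrE ?mulr_gt0// ler_wpM2l.
rewrite diracE memNset/=; last by rewrite normr0; apply/negP; rewrite -ltNge.
by rewrite lee_fin mulr_ge0// expR_ge0.
Qed.

End GaussianTail.

(** * Law of the increments of fractional Brownian motion *)

Section FbmIncrements.
Context {R : realType} {d : measure_display} {Omega : measurableType d}.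
Variables (P : probability Omega R) (alpha : R) (B : R -> Omega -> R).
Hypotheses (alpha0 : 0 < alpha) (fbmB : is_fbm P alpha B).

Lemma measurable_fbm t : measurable_fun [set: Omega] (B t).
Proof.
have [+ _] := fbmB (fun _ : 'I_1 => t) (fun=> 1).
by under eq_fun do rewrite big_ord1 mul1r.
Qed.

(** The two-point case of [is_fbm] with coefficients 1 and -1: in the quadratic form the terms
    |t|^alpha and |s|^alpha cancel. *)
Lemma fbm_increment s t :
  centered_gaussian P (fun w => B t w - B s w) (`|t - s| `^ alpha).
Proof.
have := fbmB (fun i : 'I_2 => if i == ord0 then t else s)
  (fun i => if i == ord0 then 1 else -1).
under eq_fun do rewrite !big_ord_recl big_ord0 /= mul1r mulN1r addr0.
have cov_diag x : fbm_cov alpha x x = `|x| `^ alpha.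
  by rewrite /fbm_cov subrr normr0 powR0 ?gt_eqF// subr0; field.
suff -> : \sum_(i < 2) \sum_(j < 2) (if i == ord0 then 1 else -1) *
    (if j == ord0 then 1 else -1) *
    fbm_cov alpha (if i == ord0 then t else s) (if j == ord0 then t else s) =
    `|t - s| `^ alpha by [].
rewrite !(big_ord_recl 1) !big_ord1 /= (big_ord_recl 1) big_ord1 /=.
rewrite !cov_diag /fbm_cov (distrC s t).
by move: (`|t| `^ _) (`|s| `^ _) (`|t - s| `^ _) => a b c; field.
Qed.

End FbmIncrements.

(** * Oscillation tails on intervals of length two, with two auxiliary bounds *)

Lemma nneseries_le_of_partial (R : realType) (u : nat -> \bar R) (K : R) :
  (forall n, (0 <= u n)%E) ->
  (forall N, (\sum_(n < N) u n <= K%:E)%E) ->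
  (\sum_(0 <= n <oo) u n <= K%:E)%E.
Proof.
move=> u0 uK; apply: lime_le; first exact: is_cvg_nneseries.
by apply: nearW => N; rewrite big_mkord.
Qed.

Lemma bernoulli_ge (R : realDomainType) (g : R) n : 1 <= g ->
  1 + n%:R * (g - 1) <= g ^+ n.
Proof.
move=> g1; elim: n => [|n IH]; first by rewrite mul0r addr0.
have n0 : 0 <= n%:R :> R by [].
apply: le_trans (_ : (1 + n%:R * (g - 1)) * g <= _); last first.
  by rewrite exprSr ler_wpM2r// (le_trans ler01).
have : 0 <= n%:R * (g - 1) ^+ 2 by rewrite mulr_ge0// sqr_ge0.
by rewrite -natr1 expr2; lra.
Qed.

Section Oscillation.
Context {R : realType}.
Implicit Types (alpha a v : R).

(* The increments at dyadic level [n] have standard deviation of order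
   [r ^+ (2 * n)], [r] being the chain ratio, so the summable thresholds of
   order [r ^+ n] exceed it by the growing factor [r ^- n]. *)
Definition chain_ratio alpha : R := 2 `^ (- (alpha / 4)).

Lemma chain_ratio_itv alpha : 0 < alpha -> 0 < chain_ratio alpha < 1.
Proof.
move=> a0; rewrite powR_gt0//= /chain_ratio /powR gt_eqF//.
by rewrite -[ltRHS]expR0 ltr_expR mulNr oppr_lt0 mulr_gt0 ?divr_gt0 ?ln_gt0 ?ltr1n.
Qed.

(** A countable union of increment events, hence measurable. Its thresholds sum to v over the
    levels, so for continuous paths its complement keeps the oscillation within v. *)
Definition osc_event {Omega : Type} alpha (B : R -> Omega -> R) a v : set Omega :=
  let r := chain_ratio alpha in
  \bigcup_n \bigcup_(i < (2 ^ n)%N)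
    [set w | v * ((1 - r) * r ^+ n) <=
       `|B (dyadic a n i.+1) w - B (dyadic a n i) w|].

Lemma osc_eventPn {Omega : Type} alpha (B : R -> Omega -> R) a v w :
  0 < alpha -> 0 <= v -> continuous (B ^~ w) -> ~ osc_event alpha B a v w ->
  forall s, a <= s <= a + 2 -> `|B s w - B a w| <= v.
Proof.
move=> a0 v0 cB nw; have /andP[r0 r1] := chain_ratio_itv a0.
apply: (chaining cB v0 (_ : 0 <= chain_ratio alpha <= 1)); first by rewrite !ltW.
move=> n i ni; rewrite leNgt; apply/negP => h; apply: nw.
exists n => //; exists i => //=.
exact: ltW.
Qed.

(** The gap is 2 / 2^n, and the fourth power of the chain ratio is 2^(-alpha). *)
Lemma dyadic_gap_powR alpha a n i : 0 < alpha ->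
  `|dyadic a n i.+1 - dyadic a n i| `^ alpha =
  2 `^ alpha * (chain_ratio alpha) ^+ (4 * n).
Proof.
move=> a0; rewrite /dyadic opprD addrACA subrr add0r -mulrBr -mulrBl.
rewrite -(natr1 i) (addrC i%:R) addrK mul1r.
rewrite ger0_norm; last by rewrite mulr_ge0// invr_ge0 exprn_ge0.
rewrite powRM ?invr_ge0 ?exprn_ge0//; congr (_ * _).
have e2 : (2 ^+ n)^-1 = 2 `^ (- n%:R) :> R by rewrite powR_invn.
have er : chain_ratio alpha ^+ (4 * n) = 2 `^ (- (alpha / 4) * (4 * n)%:R).
  by rewrite powRrM powR_mulrn// powR_ge0.
rewrite e2 er -powRrM natrM; congr powR.
by field.
Qed.

(** Union bound: the Gaussian exponent at level n is c v^2 g^n with g > 1, which beats the 2^n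
    intervals of that level once v is large. The constants depend on alpha alone. *)
Lemma osc_tail alpha : 0 < alpha -> exists C c : R, [/\ 0 < C, 0 < c &
  forall (d : measure_display) (Omega : measurableType d)
    (P : probability Omega R) (B : R -> Omega -> R),
    is_fbm P alpha B -> forall a v, 0 < v ->
    measurable (osc_event alpha B a v) /\
    (P (osc_event alpha B a v) <= (C * expR (- c * v ^+ 2))%:E)%E].
Proof.
move=> a0; have /andP[r0 r1] := chain_ratio_itv a0.
set r := chain_ratio alpha in r0 r1 *.
(* Squared threshold over four times the variance 2^alpha r^(4n) equals c v^2 r^(-2n). *)
pose c := (1 - r) ^+ 2 / (4 * 2 `^ alpha).
have pa : 0 < 2 `^ alpha by rewrite powR_gt0.
have c0 : 0 < c by rewrite divr_gt0 ?mulr_gt0 ?exprn_gt0// subr_gt0.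
pose g := r ^- 2.
have g1 : 1 < g by rewrite invf_gt1 ?exprn_gt0// exprn_ilt1 ?ltW.
(* For h >= T this forces 2 exp(- h (g - 1)) <= 1/2, the geometric ratio between levels. *)
pose T := ln 4 / (g - 1).
exists (4 + expR T), c; split; [by rewrite addr_gt0 ?expR_gt0|by []|].
move=> d Omega P B fbmB a v v0.
have v2 : 0 < v ^+ 2 by rewrite exprn_gt0.
set F := fun n (i : nat) => [set w | v * ((1 - r) * r ^+ n) <=
       `|B (dyadic a n i.+1) w - B (dyadic a n i) w|].
have step n i : measurable (F n i) /\
    (P (F n i) <= (2 * expR (- (c * v ^+ 2 * g ^+ n)))%:E)%E.
  have gap0 : 0 < 2 `^ alpha * r ^+ (4 * n) by rewrite mulr_gt0// exprn_gt0.
  have := centered_gaussian_tail (u := v * ((1 - r) * r ^+ n))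
    (fbm_increment a0 fbmB (dyadic a n i) (dyadic a n i.+1)) _ gap0.
  rewrite dyadic_gap_powR// => /(_ (lexx _))[|mF PF].
    by rewrite !mulr_gt0 ?exprn_gt0 ?subr_gt0.
  split => //; apply: le_trans PF _; rewrite lee_fin ler_wpM2l// ler_expR lerN2.
  rewrite le_eqVlt; apply/orP; left; apply/eqP.
  rewrite /c /g exprVn -exprM (mulnC 2) !exprMn -[r ^+ n ^+ 2]exprM.
  rewrite (_ : 4 * n = n * 2 + n * 2)%N ?exprD; last by rewrite -mulnDr mulnC.
  by field; rewrite !gt_eqF// exprn_gt0.
pose E n := \bigcup_(i < (2 ^ n)%N) F n i.
have mE n : measurable (E n) by apply: bigcup_measurable => i _; exact: (step n i).1.
have mO : measurable (\bigcup_n E n) by exact: bigcup_measurable.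
split=> //; rewrite -/r; change (P (\bigcup_n E n) <= ((4 + expR T) * expR (- c * v ^+ 2))%:E)%E.
(* Below T the trivial bound 1 is absorbed by the summand exp(T) of the constant. *)
have [hT|hT] := ltP (c * v ^+ 2) T.
  apply: le_trans (probability_le1 P mO) _; rewrite lee_fin mulrDl -expRD.
  apply: le_trans (_ : expR (T - c * v ^+ 2) <= _).
    by rewrite -expR0 ler_expR subr_ge0 ltW.
  by rewrite mulNr lerDr mulr_ge0// expR_ge0.
apply: (@le_trans _ _ (\sum_(0 <= n <oo) P (E n))%E).
  by apply: measure_sigma_subadditive.
set h := c * v ^+ 2 in hT step *.
have q_le : 2 * expR (- (h * (g - 1))) <= 2^-1.
  have : ln 4 <= h * (g - 1) by rewrite -ler_pdivrMr ?subr_gt0.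
  rewrite -ler_expR lnK ?posrE// expRN => h4.
  rewrite -ler_pdivlMl// -invfM lef_pV2 ?posrE ?expR_gt0//.
  by apply: le_trans h4; lra.
have PE n : (P (E n) <= (2 * expR (- h) * 2^-1 ^+ n)%:E)%E.
  apply: (@le_trans _ _ (\sum_(i < 2 ^ n) P (F n i))%E).
    apply: content_subadditive => //; last by rewrite /E bigcup_mkord.
    by move=> i _; exact: (step n i).1.
  apply: (@le_trans _ _ (\sum_(i < 2 ^ n) (2 * expR (- (h * g ^+ n)))%:E)%E).
    by apply: lee_sum => i _; exact: (step n i).2.
  rewrite sumEFin lee_fin sumr_const card_ord -(mulr_natl _ (2 ^ n)) natrX.
  (* Bernoulli, g^n >= 1 + n (g - 1), splits off exp(-h) and leaves an n-th power that absorbs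
     2^n. *)
  apply: le_trans (_ : 2 ^+ n * (2 * (expR (- h) * expR (- (h * (g - 1))) ^+ n)) <= _).
    rewrite !ler_wpM2l ?exprn_ge0// -expRM_natl -expRD ler_expR.
    have := bernoulli_ge n (ltW g1); rewrite -(ler_pM2l (_ : 0 < h)); last exact: mulr_gt0.
    lra.
  rewrite mulrCA -mulrA ler_wpM2l// mulrCA ler_wpM2l ?expR_ge0// -exprMn.
  by apply: lerXn2r; rewrite ?nnegrE ?mulr_ge0 ?expR_ge0 ?invr_ge0.
apply: nneseries_le_of_partial => // N.
apply: (@le_trans _ _ (\sum_(n < N) (2 * expR (- h) * 2^-1 ^+ n)%:E)%E).
  by apply: lee_sum => i _; exact: PE.
rewrite sumEFin lee_fin -mulr_sumr.
have geo : \sum_(i < N) 2^-1 ^+ i <= 2 :> R.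
  suff -> : \sum_(i < N) 2^-1 ^+ i = 2 - 2 * 2^-1 ^+ N :> R.
    by rewrite gerBl mulr_ge0// exprn_ge0.
  elim: N => [|N IH]; first by rewrite big_ord0 mulr1 subrr.
  by rewrite big_ord_recr /= IH exprS; field.
apply: le_trans (ler_wpM2l _ geo) _; first by rewrite mulr_ge0// expR_ge0.
have e0 := expR_ge0 (- h); have eT : 0 <= expR T * expR (- h) by rewrite mulr_ge0 ?expR_ge0.
by rewrite mulNr -/h; lra.
Qed.

End Oscillation.

(** * Bad blocks: necessity for a drop, and their probability *)

Section BadBlock.
Context {R : realType}.
Implicit Types (alpha L : R) (k : int).

Definition block_scale alpha k : R := (`|k|%:~R + 2) `^ (alpha / 2).

(** The last event is either empty or everything: it collects the small L and m that
    [block_dichotomy] cannot exclude. *)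
Definition bad_block {d : measure_display} {Omega : measurableType d}
    alpha (B : R -> Omega -> R) L k : set Omega :=
  let m := block_scale alpha k in
  osc_event alpha B k%:~R ((L + m) / 12)
  `|` [set w | m * (L + m) / 36 <= `|B k%:~R w - B 0 w|]
  `|` [set _ | m < 8 /\ L < 40].

(** Off the first two events [block_dichotomy] applies, with V and U the two thresholds, and its
    conclusion is the third event. *)
Lemma bad_blockP {d : measure_display} {Omega : measurableType d}
    alpha (B : R -> Omega -> R) L w (t s : R) :
  0 < alpha < 2 -> 0 <= L -> continuous (B ^~ w) -> t <= s <= t + 1 ->
  Zproc alpha B 0 w <= Zproc alpha B t w ->
  Zproc alpha B s w + L <= Zproc alpha B t w ->
  bad_block alpha B L (Num.floor t) w.
Proof.
move=> /andP[a0 a2] L0 cB ts Z0 Zs; set k := Num.floor t.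
have kt : k%:~R <= t < k%:~R + 1.
  by have := floor_itv t; rewrite -/k intrD.
have [|h1 h2 h3 h4] := powR_block (alpha := alpha) _ kt ts; first by rewrite !ltW.
apply: contrapT => nb.
have m0 : 0 <= block_scale alpha k by rewrite powR_ge0.
have nosc : ~ osc_event alpha B k%:~R ((L + block_scale alpha k) / 12) w.
  by move=> h; apply: nb; left; left.
have v0 : 0 <= (L + block_scale alpha k) / 12 by rewrite divr_ge0// addr_ge0.
have osc := osc_eventPn a0 v0 cB nosc.
have nU : `|B k%:~R w - B 0 w| <= block_scale alpha k * (L + block_scale alpha k) / 36.
  by rewrite leNgt; apply/negP => h; apply: nb; left; right; exact: ltW.
apply: nb; right => /=.
case/andP: kt => kt tk; case/andP: ts => ts st.
move: Z0 Zs; rewrite /Zproc normr0 powR0 ?gt_eqF// subr0.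
rewrite !(powR_sqr_half alpha (normr_ge0 _)) => Z0 Zs.
set m := block_scale alpha k in m0 h2 h3 h4 osc nU v0 *.
apply: (@block_dichotomy R L ((L + m) / 12) (m * (L + m) / 36)
  (`|t| `^ (alpha / 2)) (`|s| `^ (alpha / 2)) _
  (Num.sqrt 2) (B t w) (B s w) (B k%:~R w) (B 0 w)) => //.
- rewrite sqrtr_ge0/= -(@ler_pXn2r _ 2) ?nnegrE ?sqrtr_ge0// ?divr_ge0//.
  by rewrite sqr_sqrtr// expr2; lra.
- by rewrite powR_ge0.
- by rewrite powR_ge0.
- by rewrite h3; exact: h4.
- by apply: osc; apply/andP; split; lra.
- by apply: osc; apply/andP; split; lra.
Qed.

Lemma block_scale_ge1 alpha k : 0 <= alpha -> 1 <= block_scale alpha k.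
Proof.
move=> a0; apply: (@le_trans _ _ (1 `^ (alpha / 2))); first by rewrite powR1.
have k0 : 0 <= `|k|%:~R :> R by rewrite ler0z.
by apply: ge0_ler_powR; rewrite ?nnegrE; lra.
Qed.

(** B(k) - B(0) has variance |k|^alpha <= m^2, which cancels the factor m of its threshold. Both
    Gaussian exponents are then multiples of (L + m)^2 >= L^2 + m^2. *)
Lemma bad_block_tail alpha : 0 < alpha -> exists C c : R, [/\ 0 < C, 0 < c &
  forall (d : measure_display) (Omega : measurableType d)
    (P : probability Omega R) (B : R -> Omega -> R),
    is_fbm P alpha B -> forall L k, 0 <= L ->
    measurable (bad_block alpha B L k) /\
    (P (bad_block alpha B L k) <=
       (C * expR (- c * (L ^+ 2 + (`|k|%:~R + 2) `^ alpha)))%:E)%E].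
Proof.
move=> a0; have [C1 [c1 [C10 c10 osc]]] := @osc_tail R alpha a0.
pose c := Num.min (c1 / 12 ^+ 2) (4 * 36 ^+ 2)^-1.
have c0 : 0 < c by rewrite lt_min divr_gt0 ?invr_gt0 ?mulr_gt0 ?exprn_gt0.
have cc1 : c <= c1 / 12 ^+ 2 by rewrite ge_min lexx.
have cc2 : c <= (4 * 36 ^+ 2)^-1 by rewrite ge_min lexx orbT.
(* One summand per event; the exponential offsets the decay factor when L < 40 and m < 8, where the
   bound is only 1. *)
exists (C1 + 2 + expR (c * (40 ^+ 2 + 8 ^+ 2))), c; split; [|exact: c0|].
  by rewrite !addr_gt0// expR_gt0.
move=> d Omega P B fbmB L k L0.
rewrite (powR_sqr_half alpha (_ : 0 <= `|k|%:~R + 2)); last by rewrite addr_ge0// ler0z.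
rewrite -/(block_scale alpha k) /bad_block /=; set m := block_scale alpha k.
have m1 : 1 <= m by apply: block_scale_ge1; exact: ltW.
have m0 : 0 < m by apply: lt_le_trans m1.
have Lm0 : 0 < L + m by rewrite ltr_wpDl.
have sq : L ^+ 2 + m ^+ 2 <= (L + m) ^+ 2.
  by have : 0 <= L * m by [rewrite mulr_ge0// ltW]; rewrite sqrrD; lra.
have e0 : 0 <= L ^+ 2 + m ^+ 2 by rewrite addr_ge0 ?sqr_ge0.
have [mO PO] := osc d Omega P B fbmB k%:~R _ (divr_gt0 Lm0 (ltr0n R 12)).
have [mU PU] : measurable [set w | m * (L + m) / 36 <= `|B k%:~R w - B 0 w|] /\
   (P [set w | (m * (L + m) / 36 <= `|B k%:~R w - B 0 w|)%R] <=
    (2 * expR (- ((m * (L + m) / 36) ^+ 2 / (4 * m ^+ 2))))%:E)%E.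
  apply: centered_gaussian_tail (fbm_increment a0 fbmB 0 k%:~R) _ _ _.
  - rewrite subr0 (powR_sqr_half alpha (normr_ge0 _)).
    apply: lerXn2r; rewrite ?nnegrE ?powR_ge0 ?(ltW m0)//.
    apply: ge0_ler_powR; rewrite ?nnegrE ?divr_ge0 ?(ltW a0) ?addr_ge0 ?ler0z//.
    by rewrite intr_norm lerDl.
  - by rewrite exprn_gt0.
  - by rewrite !mulr_gt0// invr_gt0.
have [mS PS] : measurable [set _ : Omega | m < 8 /\ L < 40] /\
   (P [set _ : Omega | (m < 8)%R /\ (L < 40)%R] <=
    (expR (c * (40 ^+ 2 + 8 ^+ 2)) * expR (- c * (L ^+ 2 + m ^+ 2)))%:E)%E.
  have [[m8 L40]|h] := pselect (m < 8 /\ L < 40).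
    rewrite (_ : [set _ | _] = setT); last by apply/seteqP; split.
    split=> //; rewrite probability_setT lee_fin -expRD -[leLHS]expR0 ler_expR.
    have L2 : L ^+ 2 <= 40 ^+ 2 by apply: lerXn2r; rewrite ?nnegrE// ltW.
    have m2 : m ^+ 2 <= 8 ^+ 2 by apply: lerXn2r; rewrite ?nnegrE ?(ltW m0)// ltW.
    by rewrite mulNr -mulrBr mulr_ge0 ?(ltW c0)// subr_ge0 lerD.
  rewrite (_ : [set _ | _] = set0); last by apply/seteqP; split.
  by rewrite measure0 lee_fin mulr_ge0 ?expR_ge0.
split; first by do 2!apply: measurableU => //.
apply: le_trans (measureU2 _ _ mS) _; first exact: measurableU.
rewrite (mulrDl (C1 + 2)) EFinD leeD//.
apply: le_trans (measureU2 _ mO mU) _; rewrite (mulrDl C1) EFinD leeD//.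
  apply: le_trans PO _; rewrite lee_fin ler_wpM2l ?(ltW C10)// ler_expR !mulNr lerN2.
  apply: le_trans (ler_pM (ltW c0) e0 cc1 sq) _.
  by rewrite le_eqVlt; apply/orP; left; apply/eqP; field.
apply: le_trans PU _; rewrite lee_fin ler_wpM2l// ler_expR !mulNr lerN2.
apply: le_trans (ler_pM (ltW c0) e0 cc2 sq) _.
rewrite le_eqVlt; apply/orP; left; apply/eqP.
by field; rewrite gt_eqF.
Qed.

End BadBlock.

(** * From a large ratio to a drop of the path *)

Section Ratio.
Context {R : realType}.

(** The clause I < +oo reflects the convention that division by +oo gives 0, which cannot exceed x
    >= 0. *)
Lemma lt_ratio (x : R) (S I : \bar R) : 0 <= x -> (0 < I)%E ->
  (x%:E < S / I)%E <-> (x%:E * I < S)%E /\ (I < +oo)%E.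
Proof.
move=> x0; case: I => [r| |] //= r0.
  by rewrite inver gt_eqF// lte_pdivlMr// ltry; split => [|[]].
rewrite /inve mule0; split => [|[] //].
by rewrite lte_fin ltNge x0.
Qed.

(** Without a drop of ln x after t, exp(z) stays above exp(z t) / x on a unit interval, so I >=
    exp(z t) / x, contradicting the choice of t. The hypothesis on [I] is shared by the integral and
    the sum. *)
Lemma ratio_gt_drop (z : R -> R) (G : set R) (I : \bar R) (x : R) :
  G 0 -> 1 <= x -> (0 < I)%E ->
  (forall t c, G t -> 0 <= c ->
    (forall s, t <= s <= t + 1 -> c <= expR (z s)) -> (c%:E <= I)%E) ->
  (x%:E < ereal_sup [set (expR (z t))%:E | t in G] / I)%E ->
  exists t s, [/\ t <= s <= t + 1, z 0 <= z t & z s + ln x <= z t].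
Proof.
move=> G0 x1 I0 HI /(lt_ratio _ (le_trans ler01 x1) I0)[+ _].
have x0 : 0 < x by apply: lt_le_trans x1.
move=> /ereal_sup_gt[_ [t0 Gt0 <-] h0].
(* If the near-maximiser [t0] lies below z 0, the grid point 0 does at least as well. *)
have [t [Gt z0t h]] : exists t, [/\ G t, z 0 <= z t & (x%:E * I < (expR (z t))%:E)%E].
  have [z0t|/ltW z0t] := leP (z 0) (z t0); first by exists t0.
  by exists 0; split => //; apply: lt_le_trans h0 _; rewrite lee_fin ler_expR.
apply: contrapT => nex.
have : ((expR (z t) / x)%:E <= I)%E.
  apply: (HI t) => //; first by rewrite divr_ge0 ?expR_ge0// ltW.
  move=> s ts; rewrite -{1}(lnK (x := x)) ?posrE// -expRB ler_expR lerBlDr.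
  by rewrite leNgt; apply/negP => hs; apply: nex; exists t, s; split => //; exact: ltW.
rewrite leNgt => /negP; apply.
case: I I0 h {HI h0} => [r| |] // r0; last by rewrite gt0_muley ?lte_fin// ltNge leey.
by rewrite -EFinM !lte_fin ltr_pdivlMr// mulrC.
Qed.

End Ratio.

(** * Lower bounds for the denominator over a unit interval *)

Section Denominator.
Context {R : realType}.
Implicit Types (f : R -> R) (t c delta : R).

Lemma integral_ge_unit f t c : continuous f -> (forall s, 0 <= f s) ->
  (forall s, t <= s <= t + 1 -> c <= f s) ->
  (c%:E <= \int[lebesgue_measure]_(s in [set: R]) (f s)%:E)%E.
Proof.
move=> cf f0 cfs.
have mf : measurable_fun [set: R] (EFin \o f).
  by apply/measurable_EFinP; exact: continuous_measurable_fun.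
have [c0|c0] := leP 0 c; last first.
  apply: (@le_trans _ _ 0%E); first by rewrite lee_fin ltW.
  by apply: integral_ge0 => s _; rewrite lee_fin.
pose A : set R := `[t, t + 1]%classic.
apply: (@le_trans _ _ (\int[lebesgue_measure]_(s in A) (f s)%:E)%E); last first.
  by apply: ge0_subset_integral => //; [exact: measurable_itv|move=> s _; rewrite lee_fin].
apply: (@le_trans _ _ (\int[lebesgue_measure]_(s in A) (cst c%:E) s)%E).
  rewrite integral_cst/=; last exact: measurable_itv.
  rewrite lebesgue_measure_itv/= lte_fin ltrDl ltr01.
  by rewrite -EFinD addrAC subrr add0r mule1.
apply: ge0_le_integral; first exact: measurable_itv.
- by move=> s _ /=; rewrite lee_fin.
- exact: measurable_cst.
- by apply: measurable_funTS; exact: mf.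
- by move=> s /=; rewrite /A/= in_itv/= => ts; rewrite lee_fin cfs.
Qed.

Lemma esum_ge_unit f k c delta : 0 < delta <= 1 -> 0 <= c ->
  (forall s, 0 <= f s) ->
  (forall s, k%:~R * delta <= s <= k%:~R * delta + 1 -> c <= f s) ->
  (c%:E <= delta%:E * \esum_(j in [set: int]) (f (j%:~R * delta))%:E)%E.
Proof.
move=> /andP[d0 d1] c0 f0 cfs.
(* Counting the left endpoint, N grid points lie in the unit interval: (N - 1) delta <= 1, while N
   delta >= 1. *)
pose N := (Num.truncn delta^-1).+1.
have dv0 : 0 < delta^-1 by rewrite invr_gt0.
have /andP[N1 N2] := truncn_itv (ltW dv0).
rewrite -/N in N2.
pose e (i : nat) : int := (k + i%:Z)%R.
have Nc : (c%:E <= delta%:E * (N%:R * c)%:E)%E.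
  rewrite -EFinM lee_fin mulrA ler_peMl// -ler_pdivrMl// mulr1.
  exact: ltW.
apply: le_trans Nc _; rewrite lee_wpmul2l ?lee_fin ?(ltW d0)//.
apply: esum_ge; exists (e @` `I_N).
  by split => //; exact/finite_image/finite_II.
rewrite fsbig_image; last by move=> i j _ _ /addrI [].
rewrite -fsbig_ord sumEFin lee_fin.
apply: (@le_trans _ _ (\sum_(i < N) c)).
  by rewrite sumr_const card_ord mulr_natl.
apply: ler_sum => i _; apply: cfs; rewrite /e intrD mulrDl.
rewrite lerDl mulr_ge0 ?(ltW d0) ?ler0z//= lerD2l -ler_pdivlMr// mul1r.
by apply: le_trans N1; rewrite ler_nat -ltnS.
Qed.

(** Enumerates 0, -1, 1, -2, ..., turning the sum over the integers into a series for the
    measurability proof. *)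
Definition int_of_nat (n : nat) : int := if odd n then Negz n./2 else Posz n./2.

Lemma int_of_nat_bij : set_bij [set: nat] [set: int] int_of_nat.
Proof.
rewrite setTT_bijective.
exists (fun k : int => match k with Posz n => n.*2 | Negz n => n.*2.+1 end).
  move=> n; rewrite /int_of_nat; case: ifP => h /=.
    by rewrite -[RHS]odd_double_half h.
  by rewrite -[RHS]odd_double_half h.
case=> n; rewrite /int_of_nat/= odd_double/= ?doubleK//.
by rewrite uphalf_double.
Qed.

End Denominator.

(** * Continuity of the drift; measurability of the ratio *)

Lemma continuous_norm_powR (R : realType) (alpha : R) : 0 < alpha ->
  continuous (fun t : R => `|t| `^ alpha).
Proof.
move=> a0 t; have [->|t0] := eqVneq t 0.
  apply/cvgrPdist_le => /= e e0; near=> s.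
  rewrite normr0 powR0 ?gt_eqF// sub0r normrN ger0_norm ?powR_ge0//.
  apply: (@le_trans _ _ ((e `^ alpha^-1) `^ alpha)); last first.
    by rewrite -powRrM mulVf ?gt_eqF// powRr1// ltW.
  apply: ge0_ler_powR; rewrite ?nnegrE ?powR_ge0 ?(ltW a0)//.
  near: s; exists (e `^ alpha^-1) => /=; first by rewrite powR_gt0.
  by move=> s /=; rewrite sub0r normrN => /ltW.
apply: (@continuous_comp R R R (fun s => `|s|) (fun y => y `^ alpha)).
  exact: norm_continuous.
apply: differentiable_continuous; apply/derivable1_diffP.
by apply: derivable_powR; rewrite in_itv/= andbT normr_gt0.
Unshelve. all: by end_near. Qed.

Section XiMeasurable.
Context {R : realType} {d : measure_display} {Omega : measurableType d}.
Implicit Types (B : R -> Omega -> R).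

(* [B t w] is the limit of [B (floor (n t) / n) w], a countable gluing of
   measurable pieces. *)
Lemma measurable_process B : (forall t, measurable_fun [set: Omega] (B t)) ->
  (forall w, continuous (B ^~ w)) ->
  measurable_fun [set: Omega * R] (fun wt => B wt.2 wt.1).
Proof.
move=> mB cB.
pose h n (wt : Omega * R) :=
  B ((Num.floor (n.+1%:R * wt.2))%:~R / n.+1%:R) wt.1.
have n0 n : 0 < n.+1%:R :> R by rewrite ltr0n.
apply: (@measurable_fun_cvg _ _ _ _ h).
  move=> n _ A mA; rewrite setTI.
  rewrite (_ : _ @^-1` _ = \bigcup_(k : int)
      ((B (k%:~R / n.+1%:R) @^-1` A) `*` `[k%:~R / n.+1%:R, (k%:~R + 1) / n.+1%:R[%classic)).
    apply: countable_bigcupT_measurable => [|k]; first exact: countableP.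
    apply: measurableX => //.
    by rewrite -[X in measurable X]setTI; exact: mB.
  apply/seteqP; split => [[w t] /= hA|[w t] [k _ [/= hA]]].
    exists (Num.floor (n.+1%:R * t)) => //; split => //=.
    have := floor_itv (n.+1%:R * t); rewrite intrD => /andP[h1 h2].
    by rewrite in_itv/= ler_pdivrMr// ltr_pdivlMr// (mulrC t) h1.
  rewrite in_itv/= ler_pdivrMr// ltr_pdivlMr// (mulrC t) => /andP[h1 h2].
  by rewrite /h/= (@floor_def _ _ k)// intrD h1.
move=> [w t] _ /=; rewrite /h/=.
apply: (@cvg_comp _ _ _ (fun n => (Num.floor (n.+1%:R * t))%:~R / n.+1%:R)
  (B ^~ w) _ (nbhs t)); last exact: cB.
apply/cvgrPdist_le => /= e e0.
near=> n.
have /andP[h1 h2] := floor_itv (n.+1%:R * t); rewrite intrD in h2.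
rewrite -{1}(mulKf (lt0r_neq0 (n0 n)) t) (mulrC _ n.+1%:R^-1) -mulrBr normrM.
rewrite gtr0_norm ?invr_gt0// ger0_norm ?subr_ge0//.
apply: (@le_trans _ _ n.+1%:R^-1).
  by rewrite ler_piMr ?invr_ge0// lerBlDl ltW.
apply: ltW; near: n; exact: near_infty_natSinv_lt (PosNum e0).
Unshelve. all: by end_near. Qed.

(** With [xi_denominator], gives delta = 0 and delta > 0 a common form, so that [ratio_gt_drop]
    serves both. *)
Definition xi_grid (delta : R) : set R :=
  if delta == 0 then [set: R] else [set k%:~R * delta | k in [set: int]].

Definition xi_denominator alpha (delta : R) B (w : Omega) : \bar R :=
  if delta == 0
  then (\int[lebesgue_measure]_(t in [set: R]) (expR (Zproc alpha B t w))%:E)%E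
  else (delta%:E *
    \esum_(k in [set: int]) (expR (Zproc alpha B (k%:~R * delta) w))%:E)%E.

Lemma xiE alpha delta B w : xi alpha delta B w =
  (ereal_sup [set (expR (Zproc alpha B t w))%:E | t in xi_grid delta] /
   xi_denominator alpha delta B w)%E.
Proof.
rewrite /xi /xi_grid /xi_denominator; case: ifP => // _.
congr (ereal_sup _ / _)%E; apply/seteqP; split=> [_ [k _ <-]|_ [_ [k _ <-] <-]].
  by exists (k%:~R * delta) => //; exists k.
by exists k.
Qed.

Variables (alpha : R) (B : R -> Omega -> R).
Hypothesis alpha0 : 0 < alpha.
Hypotheses (mB : forall t, measurable_fun [set: Omega] (B t))
  (cB : forall w, continuous (B ^~ w)).

Lemma measurable_Zproc t : measurable_fun [set: Omega] (Zproc alpha B t).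
Proof. by apply: measurable_funB => //; apply: measurable_funM. Qed.

Lemma continuous_Zproc w : continuous (Zproc alpha B ^~ w).
Proof.
move=> t; apply: cvgB; last exact: continuous_norm_powR.
by apply: cvgM; [exact: cvg_cst|exact: cB].
Qed.

(** For delta = 0, joint measurability and Tonelli; otherwise a series of nonnegative measurable
    terms. *)
Lemma measurable_xi_denominator delta :
  measurable_fun [set: Omega] (xi_denominator alpha delta B).
Proof.
have [d0|dn0] := eqVneq delta 0.
  pose h (wt : Omega * R) : \bar R := (expR (Zproc alpha B wt.2 wt.1))%:E.
  have mZ : measurable_fun [set: Omega * R] h.
    apply/measurable_EFinP; apply: measurableT_comp => //.
    apply: measurable_funB.
      by apply: measurable_funM => //; exact: measurable_process.
    apply: (measurableT_comp (@measurable_powR R alpha)).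
    exact: (measurableT_comp (@measurable_realfun.normr_measurable R setT) measurable_snd).
  rewrite (_ : xi_denominator alpha delta B = fubini_F lebesgue_measure h); last first.
    by apply/funext => w; rewrite /xi_denominator d0 eqxx.
  by apply: measurable_fun_fubini_tonelli_F => // wt; rewrite lee_fin expR_ge0.
rewrite (_ : xi_denominator alpha delta B = fun w => (delta%:E *
    \sum_(0 <= n <oo) (expR (Zproc alpha B ((int_of_nat n)%:~R * delta) w))%:E)%E).
  apply: measurable_funeM.
  apply: (@ge0_emeasurable_sum _ _ _ setT
    (fun n w => (expR (Zproc alpha B ((int_of_nat n)%:~R * delta) w))%:E) xpredT).
    by move=> n w _ _; rewrite lee_fin expR_ge0.
  move=> n _; apply/measurable_EFinP; apply: measurableT_comp => //.
  exact: measurable_Zproc.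
apply/funext => w; rewrite /xi_denominator (negbTE dn0) (reindex_esum _ _ _ _ int_of_nat_bij).
by rewrite nneseries_esumT// => n; rewrite lee_fin expR_ge0.
Qed.

Lemma xi_denominator_ge delta w t c : 0 <= delta <= 1 -> xi_grid delta t -> 0 <= c ->
  (forall s, t <= s <= t + 1 -> c <= expR (Zproc alpha B s w)) ->
  (c%:E <= xi_denominator alpha delta B w)%E.
Proof.
move=> /andP[d0 d1]; rewrite /xi_grid /xi_denominator; case: ifPn => [_ _|dn0 [k _ <-]] c0 h.
  apply: integral_ge_unit h; last by move=> s; exact: expR_ge0.
  move=> s; apply: (@continuous_comp R R R (Zproc alpha B ^~ w) expR).
    exact: continuous_Zproc.
  exact: continuous_expR.
apply: (@esum_ge_unit R (fun s => expR (Zproc alpha B s w))) => //.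
- by rewrite lt_def dn0 d0.
- exact: h.
Qed.

Lemma xi_grid0 delta : xi_grid delta 0.
Proof. by rewrite /xi_grid; case: ifP => // _; exists 0 => //; rewrite mul0r. Qed.

(** The minimum of the continuous path Z on [0, 1] gives a positive lower bound on a unit
    interval. *)
Lemma xi_denominator_gt0 delta w : 0 <= delta <= 1 ->
  (0 < xi_denominator alpha delta B w)%E.
Proof.
move=> d01.
have [||s0 _ smin] := @EVT_min R (Zproc alpha B ^~ w) 0 (0 + 1).
- by rewrite lerDl.
- by apply: continuous_subspaceT; exact: continuous_Zproc.
apply: (@lt_le_trans _ _ (expR (Zproc alpha B s0 w))%:E).
  by rewrite lte_fin expR_gt0.
apply: (xi_denominator_ge d01 (xi_grid0 delta) (expR_ge0 _)) => s hs.
by rewrite ler_expR; apply: smin; rewrite in_itv.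
Qed.

(** The event is the union over grid points t of x D < exp(Z(t)), within D < +oo. For delta = 0 the
    admissible t form an open set, so rational t suffice. *)
Lemma measurable_xi_gt delta x : 0 <= delta <= 1 -> 0 <= x ->
  measurable [set w | (x%:E < xi alpha delta B w)%E].
Proof.
move=> d01 x0.
pose D := xi_denominator alpha delta B.
have mD : measurable_fun [set: Omega] D by exact: measurable_xi_denominator.
pose E t : set Omega := [set w | (x%:E * D w < (expR (Zproc alpha B t w))%:E)%E].
have mE t : measurable (E t).
  rewrite -[E t]setTI; apply: measurable_lte => //.
    exact: measurable_funeM.
  by apply/measurable_EFinP; apply: measurableT_comp => //; exact: measurable_Zproc.
have mfin : measurable [set w | (D w < +oo)%E].
  rewrite -[X in measurable X]setTI; apply: measurable_lte => //.
suff [T [cT [g gE]]] : exists T : countType, exists cT : countable [set: T],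
    exists g : T -> R,
    [set w | (x%:E < xi alpha delta B w)%E] =
      (\bigcup_(k : T) E (g k)) `&` [set w | (D w < +oo)%E].
  by rewrite gE; apply: measurableI => //; exact: countable_bigcupT_measurable.
have xiP w : (x%:E < xi alpha delta B w)%E <->
    (exists2 t, xi_grid delta t & E t w) /\ (D w < +oo)%E.
  rewrite xiE; rewrite (lt_ratio _ x0 (xi_denominator_gt0 w d01)).
  split=> -[h Doo]; split => //.
    by have [_ [t Gt <-] ht] := ereal_sup_gt h; exists t.
  case: h => t Gt ht; apply: lt_le_trans ht _.
  by apply: ereal_sup_ubound; exists t.
have [d0|dn0] := eqVneq delta 0; last first.
  exists int, (countableP _), (fun k => k%:~R * delta).
  apply/seteqP; split => w.
    move=> /xiP[[t + Et] Doo]; rewrite /xi_grid (negbTE dn0) => -[k _ kt].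
    by split; [exists k; [by []|rewrite kt; exact: Et]|exact: Doo].
  move=> [[k _ Ek] Doo]; apply/xiP; split => //; exists (k%:~R * delta) => //.
  by rewrite /xi_grid (negbTE dn0); exists k.
exists rat, (countableP _), ratr.
apply/seteqP; split => w.
  move=> /xiP[[t _ Et] Doo]; split => //.
  have Dfin : (x%:E * D w \is a fin_num)%E.
    have D0 := xi_denominator_gt0 w d01; rewrite fin_numM// ge0_fin_numE//.
    exact: ltW.
  have [y xD] : exists y, (x%:E * D w = y%:E)%E by exists (fine (x%:E * D w)%E); rewrite fineK.
  have oO : open [set s : R | y < expR (Zproc alpha B s w)].
    apply: (@open_comp R R (fun s => expR (Zproc alpha B s w)) [set r | y < r]);
      last exact: open_gt.
    move=> s _; apply: (@continuous_comp R R R (Zproc alpha B ^~ w) expR).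
      exact: continuous_Zproc.
    exact: continuous_expR.
  have [] := @dense_rat R _ _ oO; first by exists t; move: Et; rewrite /E/= xD lte_fin.
  move=> s [hs [q _ qs]]; have Es : E s w by rewrite /E/= xD lte_fin; exact: hs.
  by exists q; [by []|rewrite qs; exact: Es].
move=> [[q _ Eq] Doo]; apply/xiP; split => //; exists (ratr q) => //.
by rewrite /xi_grid d0 eqxx.
Qed.

End XiMeasurable.

(** * Union bound over all blocks *)

Theorem theorem2p3 (R : realType) (alpha : R) :
  0 < alpha < 2 ->
  exists C1 C2 : R, 0 < C1 /\ 0 < C2 /\
    forall (d : measure_display) (Omega : measurableType d)
           (P : probability Omega R) (B : R -> Omega -> R),
      is_fbm P alpha B ->
      (forall w : Omega, continuous (fun t : R => B t w)) ->
      forall x delta : R, 1 <= x -> 0 <= delta <= 1 ->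
        measurable [set w | (x%:E < xi alpha delta B w)%E] /\
        (P [set w | (x%:E < xi alpha delta B w)%E]
           <= (C1 * expR (- C2 * (ln x) ^+ 2))%:E)%E.
Proof.
move=> a02; have /andP[a0 a2] := a02.
have [C [c [C0 c0 tail]]] := @bad_block_tail R alpha a0.
have [K K0 sumK] := @expR_powR_summable R alpha c a0 c0.
(* The 2 counts the blocks n and -n, C is the bound for one block, K sums over n. *)
exists (2 * C * K), c; split; first by rewrite !mulr_gt0.
split=> // d Omega P B fbmB cB x delta x1 d01.
have mB := measurable_fbm fbmB.
have mxi : measurable [set w | (x%:E < xi alpha delta B w)%E].
  by apply: measurable_xi_gt => //; exact: le_trans x1.
split=> //; set L := ln x.
have L0 : 0 <= L by rewrite ln_ge0.
pose bad (k : int) := bad_block alpha B L k.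
(* At n = 0 the two blocks coincide, which only doubles that term of the bound. *)
pose F (n : nat) := bad (Posz n) `|` bad (- Posz n).
have mbad k : measurable (bad k) by have [] := tail d Omega P B fbmB L k L0.
have mF n : measurable (F n) by exact: measurableU.
have sub : [set w | (x%:E < xi alpha delta B w)%E] `<=` \bigcup_n F n.
  move=> w /=; rewrite xiE => h.
  have [t [s [ts z0 zs]]] := ratio_gt_drop (xi_grid0 delta) x1
    (xi_denominator_gt0 a0 cB w d01)
    (fun t c Gt c0 => @xi_denominator_ge _ _ _ _ _ a0 cB delta w t c d01 Gt c0) h.
  have := bad_blockP a02 L0 (cB w) ts z0 zs.
  case: (intP (Num.floor t)) => [|n|n] hb; first by exists 0%N => //; left.
    by exists n.+1 => //; left.
  by exists n.+1 => //; right.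
apply: le_trans (measure_sigma_subadditive P mF mxi sub) _.
pose u n := 2 * C * expR (- c * L ^+ 2) * expR (- c * (n%:R + 2) `^ alpha).
have FE n : (P (F n) <= (u n)%:E)%E.
  apply: le_trans (measureU2 P (mbad _) (mbad _)) _.
  have [_ h1] := tail d Omega P B fbmB L (Posz n) L0.
  have [_ h2] := tail d Omega P B fbmB L (- Posz n) L0.
  apply: le_trans (leeD h1 h2) _.
  by rewrite normrN -EFinD lee_fin /u mulrDr expRD /= -!mulrA; lra.
apply: nneseries_le_of_partial => // N.
apply: (@le_trans _ _ (\sum_(n < N) (u n)%:E)%E).
  by apply: lee_sum => i _; exact: FE.
rewrite sumEFin lee_fin -mulr_sumr [leRHS]mulrAC; apply: ler_wpM2l (sumK N).
by rewrite !mulr_ge0 ?expR_ge0// ltW.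
Qed.
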